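(* Let $a_0,\dots,a_{15}\in\mathbb{Z}$ and let $N_1,N_2,N_4,N_8,N_{16}$ be as defined in the context. The following three conditions are equivalent: (1) $D(a_0,\dots,a_{15}) = N_1N_2N_4N_8N_{16} \in 64\,\mathbb{Z}_{\rm odd}$; (2) $N_1, N_2 \in 2\,\mathbb{Z}_{\rm odd}$ and $N_4N_8N_{16} \in 16\,\mathbb{Z}_{\rm odd}$; (3) $N_1, N_2, N_4 \in 2\,\mathbb{Z}_{\rm odd}$ and $N_8N_{16}\in 8\,\mathbb{Z}_{\rm odd}$.
   Context: $D(a_0,\dots,a_{15})$ is the determinant of the $16\times16$ matrix with $(i,j)$ entry $a_{(i-j)\bmod 16}$ ($0\le i,j\le 15$). Let $f(x)=\sum_{k=0}^{15}a_kx^k$ and $\zeta_{16}=e^{2\pi\sqrt{-1}/16}$. For each divisor $d$ of $16$, $N_d := \prod_{0\le l\le 15,\ \gcd(l,16)=d} f(\zeta_{16}^l)$ (with the convention $\gcd(0,16)=16$); each $N_d$ is an integer, and $D(a_0,\dots,a_{15})=\prod_{d\mid 16}N_d$. $\mathbb{Z}_{\rm odd}$ is the set of odd integers and $c\,\mathbb{Z}_{\rm odd}=\{cn : n \text{ odd}\}$. *)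

(* Defs.v *)
From HB Require Import structures.
From mathcomp Require Import all_boot all_order all_algebra.
From mathcomp Require Import reals trigo.
From mathcomp Require Import complex.

Set Implicit Arguments.
Unset Strict Implicit.
Unset Printing Implicit Defensive.

Import Order.TTheory GRing.Theory Num.Theory.
Local Open Scope ring_scope.
Local Open Scope complex_scope.

(* The subtraction i - j is that of the cyclic group 'I_16, hence modulo 16. *)
Definition circulant_det (a : 'I_16 -> int) : int :=
  \det (\matrix_(i < 16, j < 16) a (i - j)).

Definition zeta16 (R : realType) : R[i] :=
  cos (2 * pi / 16) +i* sin (2 * pi / 16).

Definition coef_poly16 (a : 'I_16 -> int) : {poly int} :=
  \sum_(k < 16) a k *: 'X^k.

(* Since gcdn 0 16 = 16, the index l = 0 contributes to d = 16. *)
Definition subnorm (R : realType) (a : 'I_16 -> int) (d : nat) : R[i] :=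
  \prod_(l < 16 | gcdn l 16 == d)
    (map_poly intr (coef_poly16 a)).[zeta16 R ^+ l].

(* z lies in c Z_odd, where the integers are embedded in the complex numbers. *)
Definition in_odd_multiples (R : realType) (c : int) (z : R[i]) : Prop :=
  exists2 n : int, ~~ (2 %| n)%Z & z = (c * n)%:~R.

(* Main.v *)
(** With G f = A^2 - X B^2, where f = A(X^2) + X B(X^2), one has
    f(x) f(-x) = (G f)(x^2), so that N_16 = f(1), N_8 = f(-1), N_4 = (G f)(-1),
    N_2 = (G^2 f)(-1) and N_1 = (G^3 f)(-1).  The parities of A(1) and B(1) are
    invariant under G.  If D is even they agree: when both are odd, N_1, N_2 and
    N_4 are twice an odd number; when both are even, 4 divides N_1, N_2 and N_4
    while 2 divides N_8 and N_16, hence 256 divides D, which excludes 64 Z_odd. *)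
Require Import Defs.
From mathcomp Require Import all_boot all_order all_algebra.
From mathcomp Require Import reals trigo.
From mathcomp Require Import complex.
From mathcomp Require Import zify ring.

Import Order.TTheory GRing.Theory Num.Theory.
Local Open Scope ring_scope.
Local Open Scope complex_scope.

(** * The root-squaring transform of Dandelin and Graeffe *)

Definition graeffe {R : comNzRingType} (p : {poly R}) : {poly R} :=
  even_poly p ^+ 2 - 'X * odd_poly p ^+ 2.

Lemma horner_even_odd {R : comNzRingType} (p : {poly R}) (x : R) :
  p.[x] = (even_poly p).[x ^+ 2] + (odd_poly p).[x ^+ 2] * x.
Proof. by rewrite -{1}(poly_even_odd p) !hornerE !horner_comp !hornerE. Qed.

Lemma hornerM_graeffe {R : comNzRingType} (p : {poly R}) (x : R) :
  p.[x] * p.[- x] = (graeffe p).[x ^+ 2].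
Proof.
rewrite (horner_even_odd p x) (horner_even_odd p (- x)) sqrrN /graeffe.
by rewrite !(hornerD, hornerN, hornerM, hornerX, horner_exp); ring.
Qed.

Lemma map_graeffe {R S : comNzRingType} (f : {rmorphism R -> S}) (p : {poly R}) :
  map_poly f (graeffe p) = graeffe (map_poly f p).
Proof.
have map_even q : map_poly f (even_poly q) = even_poly (map_poly f q).
  by apply/polyP => i; rewrite !(coef_even_poly, coef_map).
have map_odd q : map_poly f (odd_poly q) = odd_poly (map_poly f q).
  by apply/polyP => i; rewrite !(coef_odd_poly, coef_map).
by rewrite /graeffe !expr2 rmorphB !rmorphM /= map_polyX map_even map_odd.
Qed.

Lemma horner1_even_odd {R : comNzRingType} (p : {poly R}) :
  p.[1] = (even_poly p).[1] + (odd_poly p).[1].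
Proof. by rewrite horner_even_odd expr1n mulr1. Qed.

Lemma hornerN1_even_odd {R : comNzRingType} (p : {poly R}) :
  p.[-1] = (even_poly p).[1] - (odd_poly p).[1].
Proof. by rewrite horner_even_odd sqrrN expr1n mulrN1. Qed.

Lemma graeffe_hornerN1 {R : comNzRingType} (p : {poly R}) :
  (graeffe p).[-1] = (even_poly p).[-1] ^+ 2 + (odd_poly p).[-1] ^+ 2.
Proof. by rewrite !(hornerD, hornerN, hornerM, hornerX, horner_exp) mulN1r opprK. Qed.

(** * Parity and divisibility by 4 at 1 and -1 *)

Lemma dvd2M (m n : int) : (2 %| m * n)%Z = (2 %| m)%Z || (2 %| n)%Z.
Proof. by rewrite !dvdzE abszM Euclid_dvdM. Qed.

(** Stated with a witness rather than as a divisibility, so that it can be rewritten with before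
    [lia] or [ring]. *)
Lemma hornerN1_mod2 (p : {poly int}) : exists k, p.[-1] = p.[1] - 2 * k.
Proof.
by exists (odd_poly p).[1]; rewrite hornerN1_even_odd (horner1_even_odd p); ring.
Qed.

(** The values of [graeffe p] at 1 and -1 are both computable from the two halves of [p], and their
    difference is twice the value at 1 of the odd half of [graeffe p]. *)
Lemma dvd2_odd_poly_graeffe (p : {poly int}) :
  (2 %| (odd_poly (graeffe p)).[1])%Z = (2 %| (odd_poly p).[1])%Z.
Proof.
have g1 := horner1_even_odd (graeffe p).
have gN1 := hornerN1_even_odd (graeffe p).
have := hornerM_graeffe p 1; rewrite expr1n hornerN1_even_odd (horner1_even_odd p).
have [[u Eu] [v Ov]] := (hornerN1_mod2 (even_poly p), hornerN1_mod2 (odd_poly p)).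
move: gN1; rewrite graeffe_hornerN1 {}Eu {}Ov {}g1.
move: (even_poly p).[1] (odd_poly p).[1] => E O.
move: (even_poly _).[1] (odd_poly _).[1] => E' O' gN1 g1.
(* Half of the difference between E^2 - O^2, the value at 1, and (E - 2u)^2 + (O - 2v)^2, the value
   at -1. *)
have -> : O' = - O ^+ 2 + 2 * (E * u + O * v - u ^+ 2 - v ^+ 2) by lia.
(* O^2 has the parity of O; once the nonlinear terms are made atoms, the goal is linear. *)
have := dvd2M O O; rewrite orbb -expr2.
move: (O ^+ 2) (_ - v ^+ 2) => O2 t; lia.
Qed.

Lemma dvd4_graeffe_hornerN1 (p : {poly int}) :
    (2 %| (even_poly p).[1])%Z -> (2 %| (odd_poly p).[1])%Z ->
  (4 %| (graeffe p).[-1])%Z.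
Proof.
have [[u Eu] [v Ov]] := (hornerN1_mod2 (even_poly p), hornerN1_mod2 (odd_poly p)).
rewrite graeffe_hornerN1 Eu Ov => /dvdzP[e ->] /dvdzP[o ->].
apply/dvdzP; exists ((e - u) ^+ 2 + (o - v) ^+ 2); ring.
Qed.

(** The value is a sum of two odd squares, hence 2 modulo 4. The witness comes from (2s + 1)^2 =
    4(s^2 + s) + 1, with s = e - u and s = o - v. *)
Lemma graeffe_hornerN1_odd (p : {poly int}) :
    ~~ (2 %| (even_poly p).[1])%Z -> ~~ (2 %| (odd_poly p).[1])%Z ->
  exists2 n, ~~ (2 %| n)%Z & (graeffe p).[-1] = 2 * n.
Proof.
have [[u Eu] [v Ov]] := (hornerN1_mod2 (even_poly p), hornerN1_mod2 (odd_poly p)).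
rewrite graeffe_hornerN1 Eu Ov => oddE oddO.
have [e ->] : exists e, (even_poly p).[1] = e * 2 + 1.
  by exists ((even_poly p).[1] %/ 2)%Z; lia.
have [o ->] : exists o, (odd_poly p).[1] = o * 2 + 1.
  by exists ((odd_poly p).[1] %/ 2)%Z; lia.
exists (2 * ((e - u) ^+ 2 + (e - u) + (o - v) ^+ 2 + (o - v)) + 1); last by ring.
lia.
Qed.

Lemma dvd2_even_poly (p : {poly int}) : (2 %| p.[1])%Z ->
  (2 %| (even_poly p).[1])%Z = (2 %| (odd_poly p).[1])%Z.
Proof. 
rewrite (horner1_even_odd p); move: (even_poly p).[1] (odd_poly p).[1] => E O even_p.
by apply/idP/idP; lia.
Qed.

Lemma dvd2_hornerN1 (p : {poly int}) : (2 %| p.[-1])%Z = (2 %| p.[1])%Z.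
Proof.
by have [k ->] := hornerN1_mod2 p; move: p.[1] => x; apply/idP/idP; lia.
Qed.

Lemma dvd2_horner1_graeffe (p : {poly int}) :
  (2 %| (graeffe p).[1])%Z = (2 %| p.[1])%Z.
Proof.
by have := hornerM_graeffe p 1; rewrite expr1n => <-; rewrite dvd2M dvd2_hornerN1 orbb.
Qed.

Lemma graeffe_product_64 (p : {poly int}) (m : int)
    (g := graeffe p) (h := graeffe g) :
    ~~ (2 %| m)%Z ->
    (graeffe h).[-1] * h.[-1] * g.[-1] * p.[-1] * p.[1] = 64 * m ->
  [/\ exists2 n, ~~ (2 %| n)%Z & (graeffe h).[-1] = 2 * n,
      exists2 n, ~~ (2 %| n)%Z & h.[-1] = 2 * n,
      exists2 n, ~~ (2 %| n)%Z & g.[-1] = 2 * n &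
      exists2 n, ~~ (2 %| n)%Z & p.[-1] * p.[1] = 8 * n].
Proof.
move=> odd_m def_m.
(* Some factor of the product is even, and every factor has the parity of p(1). *)
have even_p : (2 %| p.[1])%Z.
  have : (2 %| 64 * m)%Z by rewrite dvdz_mulr.
  by rewrite -def_m !dvd2M !dvd2_hornerN1 !dvd2_horner1_graeffe !orbb.
have even_g : (2 %| g.[1])%Z by rewrite dvd2_horner1_graeffe.
have even_h : (2 %| h.[1])%Z by rewrite dvd2_horner1_graeffe.
have := (dvd2_even_poly p even_p, dvd2_even_poly g even_g,
         dvd2_even_poly h even_h).
rewrite !dvd2_odd_poly_graeffe.
case: (boolP (2 %| (odd_poly p).[1])%Z) => [evenO|oddO] [[Ep Eg] Eh].
  have d4g : (4 %| g.[-1])%Z by apply: dvd4_graeffe_hornerN1.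
  have d4h : (4 %| h.[-1])%Z.
    by apply: dvd4_graeffe_hornerN1; rewrite ?dvd2_odd_poly_graeffe.
  have d4h' : (4 %| (graeffe h).[-1])%Z.
    by apply: dvd4_graeffe_hornerN1; rewrite ?dvd2_odd_poly_graeffe.
  have even_pN : (2 %| p.[-1])%Z by rewrite dvd2_hornerN1.
  (* Here 256 divides 64 m, so 4 divides m, which is odd. *)
  have : (4 * 4 * 4 * 2 * 2 %| 64 * m)%Z by rewrite -def_m !dvdz_mul.
  lia.
have [n1 odd1 def1] : exists2 n, ~~ (2 %| n)%Z & (graeffe h).[-1] = 2 * n.
  by apply: graeffe_hornerN1_odd; rewrite ?Eh ?dvd2_odd_poly_graeffe.
have [n2 odd2 def2] : exists2 n, ~~ (2 %| n)%Z & h.[-1] = 2 * n.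
  by apply: graeffe_hornerN1_odd; rewrite ?Eg ?dvd2_odd_poly_graeffe.
have [n4 odd4 def4] : exists2 n, ~~ (2 %| n)%Z & g.[-1] = 2 * n.
  by apply: graeffe_hornerN1_odd; rewrite ?Ep.
split; [by exists n1 | by exists n2 | by exists n4 |].
move: def_m; rewrite def1 def2 def4 => def_m.
have {}def_m : n1 * n2 * n4 * (p.[-1] * p.[1]) = 8 * m by lia.
(* The three odd cofactors are coprime to 8, so Gauss's lemma puts the whole factor 8 into p(-1)
   p(1); the quotient divides m, hence is odd. *)
have co8 : coprimez 8 (n1 * n2 * n4).
  rewrite coprimezE -[`|8|%N]/(2 ^ 3)%N coprime_pexpl // coprime2n.
  by rewrite -[odd _]negbK -dvdn2 -(dvdzE 2) !dvd2M !negb_or odd1 odd2.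
have : (8 %| n1 * n2 * n4 * (p.[-1] * p.[1]))%Z by rewrite def_m dvdz_mulr.
rewrite Gauss_dvdzr // => /dvdzP[k def_k].
exists k; last by rewrite def_k mulrC.
have : m = n1 * n2 * n4 * k by move: def_m; rewrite def_k; lia.
by move: odd_m => /[swap] ->; rewrite !dvd2M !negb_or => /andP[].
Qed.

(** * The 16th roots of unity and the factorization of the circulant *)

Lemma zeta16_exp8 (R : realType) : zeta16 R ^+ 8 = -1.
Proof.
have dbl (x : R) : (cos x +i* sin x) ^+ 2 = cos (x + x) +i* sin (x + x).
  by rewrite cosD sinD expr2; simpc; congr (_ +i* _); rewrite mulrC.
(* The eighth power is three successive doublings of the angle, from pi / 8 to pi. *)
rewrite /zeta16 (exprM _ 4 2) (exprM _ 2 2) !dbl.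
have -> : 2 * pi / 16 + 2 * pi / 16 + (2 * pi / 16 + 2 * pi / 16) +
   (2 * pi / 16 + 2 * pi / 16 + (2 * pi / 16 + 2 * pi / 16)) = pi :> R by field.
by rewrite cospi sinpi; apply/eqP; rewrite eq_complex /= oppr0 !eqxx.
Qed.

Lemma zeta16_prim (R : realType) : 16.-primitive_root (zeta16 R).
Proof.
have z16 : zeta16 R ^+ 16 = 1 by rewrite (exprM _ 8 2) zeta16_exp8 sqrrN expr1n.
have [k prim_k k_dvd] : {m | m.-primitive_root (zeta16 R) & (m %| 16)%N}.
  exact: prim_order_exists.
suff -> : 16%N = k by [].
(* The only divisor of 16 that does not divide 8 is 16 itself. *)
have : ~~ (k %| 8)%N.
  by rewrite (prim_order_dvd prim_k) zeta16_exp8 eqNr oner_eq0.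
have : (k <= 16)%N by exact: dvdn_leq.
by move: k k_dvd {prim_k}; do 17?case=> //.
Qed.

Lemma coef_poly16E (R : comNzRingType) (a : 'I_16 -> int) (x : R) :
  (map_poly intr (coef_poly16 a)).[x] = \sum_(k < 16) (a k)%:~R * x ^+ k.
Proof.
rewrite /coef_poly16 rmorph_sum horner_sum; apply: eq_bigr => k _.
by rewrite /= map_polyZ map_polyXn !hornerE.
Qed.

(** The rows of the Vandermonde matrix of the powers of z are left eigenvectors of the circulant,
    with eigenvalues f(z^l). These powers are distinct, so the Vandermonde determinant is nonzero
    and cancels. *)
Lemma circulant_detE (R : realType) (a : 'I_16 -> int) :
  (circulant_det a)%:~R =
  \prod_(l < 16) (map_poly intr (coef_poly16 a)).[zeta16 R ^+ l] :> R[i].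
Proof.
set z := zeta16 R; have zP : 16.-primitive_root z := zeta16_prim R.
pose w : 'rV[R[i]]_16 := \row_l z ^+ l.
pose C : 'M[int]_16 := \matrix_(i, j) a (i - j).
pose d : 'rV[R[i]]_16 := \row_l (map_poly intr (coef_poly16 a)).[z ^+ l].
pose W := (Vandermonde 16 w)^T.
have detW : \det W != 0.
  rewrite det_tr det_Vandermonde; apply/prodf_neq0 => i _.
  apply/prodf_neq0 => j lt_ij; rewrite !mxE subr_eq0 (eq_prim_root_expr zP).
  by rewrite !modn_small // gtn_eqF.
have WC : W *m map_mx intr C = diag_mx d *m W.
  rewrite mul_diag_mx; apply/matrixP => l j; rewrite !mxE coef_poly16E mulr_suml.
  (* Translation by j in the cyclic group 'I_16 turns a (i - j) into a k; the exponent k + j is then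
     reduced modulo 16, harmlessly since z^16 = 1. *)
  rewrite (reindex (fun k : 'I_16 => k + j)) /=; last first.
    by exists (fun i => i - j) => k _; rewrite ?addrK ?subrK.
  apply: eq_bigr => k _; rewrite !mxE addrK mulrC -mulrA -exprD -!exprM; congr (_ * _).
  by rewrite ![(l * _)%N]mulnC !exprM (prim_expr_mod zP) exprD.
have := congr1 determinant WC; rewrite !det_mulmx mulrC => /(mulIf detW).
rewrite det_map_mx det_diag => ->; apply: eq_bigr => l _.
by rewrite mxE.
Qed.

(** Over an explicit list of indices, simplification can enumerate the factors. *)
Lemma subnorm_seq (R : realType) (a : 'I_16 -> int) (d : nat) :
  subnorm R a d = \prod_(l <- [seq l <- iota 0 16 | gcdn l 16 == d])
    (map_poly intr (coef_poly16 a)).[zeta16 R ^+ l].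
Proof.
by rewrite big_filter -[iota _ _]/(index_iota 0 16) big_mkord.
Qed.

Lemma subnormE (R : realType) (a : 'I_16 -> int) (p := coef_poly16 a) :
  [/\ subnorm R a 1 = (graeffe (graeffe (graeffe p))).[-1]%:~R,
      subnorm R a 2 = (graeffe (graeffe p)).[-1]%:~R,
      subnorm R a 4 = (graeffe p).[-1]%:~R,
      subnorm R a 8 = p.[-1]%:~R & subnorm R a 16 = p.[1]%:~R].
Proof.
set z := zeta16 R.
have z8 : z ^+ 8 = -1 := zeta16_exp8 R.
have map_horner (q : {poly int}) x : q.[x]%:~R = (map_poly intr q).[x%:~R] :> R[i].
  by rewrite horner_map.
rewrite !map_horner !rmorphN !rmorph1 !map_graeffe.
pose F := map_poly intr p : {poly R[i]}.
(* Since z^8 = -1, the points z^k and z^(k + 8) are opposite, with common square z^(2k). Starting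
   from -1 = z^8, three unfoldings give the exponents 4, 12, then 2, 6, 10, 14, then all the odd
   ones. *)
have pair q k : (graeffe q).[z ^+ (k * 2)] = q.[z ^+ k] * q.[z ^+ (k + 8)].
  by rewrite exprD z8 mulrN1 hornerM_graeffe -exprM.
rewrite !subnorm_seq /= !big_cons big_nil -/p -/z -/F !mulr1 -z8.
split; rewrite // !(pair _ 4, pair _ 2, pair _ 6).
all: rewrite ?(pair _ 1, pair _ 3, pair _ 5, pair _ 7); ring.
Qed.

Lemma circulant_det_subnorm (R : realType) (a : 'I_16 -> int) (N := subnorm R a) :
  (circulant_det a)%:~R = N 1%N * N 2%N * N 4%N * N 8%N * N 16%N.
Proof.
rewrite circulant_detE /N !subnorm_seq.
rewrite -(big_mkord predT (fun l => (map_poly intr (coef_poly16 a)).[_ ^+ l])).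
rewrite /index_iota /= !big_cons big_nil !mulr1; ring.
Qed.

Theorem theorem3p1 (R : realType) (a : 'I_16 -> int) :
  let N : nat -> R[i] := subnorm R a in
  let D : R[i] := (circulant_det a)%:~R in
  D = N 1%N * N 2%N * N 4%N * N 8%N * N 16%N /\
  [<-> in_odd_multiples 64 D;
       [/\ in_odd_multiples 2 (N 1%N), in_odd_multiples 2 (N 2%N)
         & in_odd_multiples 16 (N 4%N * N 8%N * N 16%N)];
       [/\ in_odd_multiples 2 (N 1%N), in_odd_multiples 2 (N 2%N),
           in_odd_multiples 2 (N 4%N)
         & in_odd_multiples 8 (N 8%N * N 16%N)]].
Proof.
move=> N D.
have [N1 N2 N4 N8 N16] := subnormE R a; rewrite -!/(N _) in N1 N2 N4 N8 N16.
have defD : D = N 1%N * N 2%N * N 4%N * N 8%N * N 16%N.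
  exact: circulant_det_subnorm.
have mul_odd (m n : int) : ~~ (2 %| m)%Z -> ~~ (2 %| n)%Z -> ~~ (2 %| m * n)%Z.
  by rewrite dvd2M negb_or => -> ->.
have step13 : in_odd_multiples 64 D ->
    [/\ in_odd_multiples 2 (N 1%N), in_odd_multiples 2 (N 2%N),
        in_odd_multiples 2 (N 4%N) & in_odd_multiples 8 (N 8%N * N 16%N)].
  (* All five norms are images of integers, so the equation descends to the integers, where
     divisibility makes sense. *)
  case=> m odd_m; rewrite defD N1 N2 N4 N8 N16 -!rmorphM => /intr_inj def_m.
  by have [[n1 ? ->] [n2 ? ->] [n4 ? ->] [n ? ->]] := graeffe_product_64 _ _ odd_m def_m;
    split; [exists n1 | exists n2 | exists n4 | exists n].
have step21 : [/\ in_odd_multiples 2 (N 1%N), in_odd_multiples 2 (N 2%N)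
    & in_odd_multiples 16 (N 4%N * N 8%N * N 16%N)] -> in_odd_multiples 64 D.
  case=> -[n1 odd1 def1] [n2 odd2 def2] [n odd_n def_n].
  exists (n1 * n2 * n); first by rewrite !mul_odd.
  rewrite defD -!mulrA def1 def2 [N 4%N * _]mulrA def_n -!rmorphM; congr _%:~R; ring.
have step32 : [/\ in_odd_multiples 2 (N 1%N), in_odd_multiples 2 (N 2%N),
        in_odd_multiples 2 (N 4%N) & in_odd_multiples 8 (N 8%N * N 16%N)] ->
    [/\ in_odd_multiples 2 (N 1%N), in_odd_multiples 2 (N 2%N)
      & in_odd_multiples 16 (N 4%N * N 8%N * N 16%N)].
  case=> odd1 odd2 [n4 odd4 def4] [n odd_n def_n]; split=> //.
  exists (n4 * n); first exact: mul_odd.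
  rewrite -mulrA def4 def_n -rmorphM; congr _%:~R; ring.
(* [tfae] asks for (1) to (2), (2) to (3) and (3) to (1); each is a composite of two of the
   implications above. *)
split=> //; tfae; [by move=> /step13/step32 | by move=> /step21/step13 |].
by move=> /step32/step21.
Qed.
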